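(* Let $\theta<\kappa$ be infinite regular cardinals. For a subset $S\subseteq E^\kappa_\theta$, the following are equivalent: (1) for every $\gamma\in E^\kappa_{>\omega}$, $S\cap\gamma$ is nonstationary in $\gamma$; (2) there exists a coloring $c:[\kappa]^2\to\theta$ for which $\partial(c)\supseteq S$; (3) there exists an $S$-coherent, closed coloring $c:[\kappa]^2\to\theta$ for which $\partial(c)\supseteq S$.
   Context: $E^\kappa_\theta=\{\alpha<\kappa\mid\mathrm{cf}(\alpha)=\theta\}$, $E^\kappa_{>\omega}=\{\alpha<\kappa\mid\mathrm{cf}(\alpha)>\omega\}$. For a set $a$ of ordinals: $\mathrm{ssup}(a)=\sup\{\alpha+1\mid\alpha\in a\}$, $\mathrm{acc}^+(a)=\{\alpha<\mathrm{ssup}(a)\mid \sup(a\cap\alpha)=\alpha>0\}$, $\mathrm{acc}(a)=a\cap\mathrm{acc}^+(a)$. For $c:[\kappa]^2\to\theta$ write $c(\alpha,\beta)$ for $c(\{\alpha,\beta\})$, $\alpha<\beta$, and $D^c_{\le i}(\beta)=\{\alpha<\beta\mid c(\alpha,\beta)\le i\}$. $c$ is closed if $\mathrm{acc}^+(D^c_{\le i}(\beta))\subseteq D^c_{\le i}(\beta)$ for all $\beta<\kappa$, $i\le\theta$. $\partial(c)=\{\beta\in\mathrm{acc}(\kappa)\mid\forall\gamma<\kappa\,\forall i<\theta\ \sup(D^c_{\le i}(\gamma)\cap\beta)<\beta\}$. For $S\subseteq\mathrm{acc}(\kappa)$, $c$ is $S$-coherent if for all $\beta\le\gamma<\delta<\kappa$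 with $\beta\in S$, $\sup\{\alpha<\beta\mid c(\alpha,\gamma)\ne c(\alpha,\delta)\}<\beta$. *)

(* Defs.v *)
From mathcomp Require Import all_boot all_order.
From mathcomp Require Import all_classical.

Set Implicit Arguments.
Unset Strict Implicit.
Unset Printing Implicit Defensive.

Import Order.TTheory.
Local Open Scope classical_set_scope.
Local Open Scope order_scope.

(* The cardinal kappa is presented as a well-ordered type K: the elements of K
   are the ordinals below kappa, and [\bot] is the ordinal 0.  An ordinal
   alpha < kappa is an element of K; as a von Neumann ordinal it is the initial
   segment [below alpha], while kappa itself is [[set: K]].  Notions needed
   both for kappa and for ordinals below it are stated for initial segments. *)
Section Ordinals.
Context {d : Order.disp_t} {K : bOrderType d}.
Implicit Types (alpha beta gamma delta tau theta i : K) (a A C S : set K).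

Definition below alpha : set K := [set xi | xi < alpha].

Definition least A : K := xget \bot (A `&` lbound A).

(* sup of a set of ordinals that is bounded in K, with sup of set0 equal to 0 *)
Definition osup a : K := supremum \bot a.

(* The supremum of the successors of the members of a, as a von Neumann
   ordinal (the union of the xi + 1 for xi in a), since it may equal kappa. *)
Definition ssup a : set K := \bigcup_(xi in a) [set alpha | alpha <= xi].

Definition accp a : set K :=
  [set alpha | ssup a alpha /\ (osup (a `&` below alpha) = alpha /\ \bot < alpha)].

Definition acc a : set K := a `&` accp a.

(* acc [set: K] is the set of nonzero limit ordinals below kappa. *)
Definition omega : K := least (acc [set: K]).

Definition has_cofinal_map tau A : Prop :=
  exists f : K -> K,
    (forall xi, xi < tau -> A (f xi)) /\
    (forall alpha, A alpha -> exists2 xi, xi < tau & alpha <= f xi).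

Definition cf alpha : K := least [set tau | has_cofinal_map tau (below alpha)].

Definition infinite_regular_cardinal A : Prop :=
  [/\ infinite_set A,
      forall alpha, A alpha -> ~ (A #<= below alpha)%card &
      forall alpha, A alpha -> ~ has_cofinal_map alpha A].

Definition E_eq theta : set K := [set alpha | cf alpha = theta].

Definition E_gt_omega : set K := [set alpha | omega < cf alpha].

Definition club gamma C : Prop :=
  [/\ C `<=` below gamma, osup C = gamma & accp C `<=` C].

Definition stationary gamma S : Prop :=
  S `<=` below gamma /\ forall C, club gamma C -> S `&` C !=set0.

(* A coloring of the unordered pairs from kappa is a binary function whose
   value at (alpha, beta) is only meaningful when alpha < beta. *)
Definition coloring theta (c : K -> K -> K) : Prop :=
  forall alpha beta, alpha < beta -> c alpha beta < theta.

Implicit Type c : K -> K -> K.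

Definition D_le c i beta : set K :=
  [set alpha | alpha < beta /\ c alpha beta <= i].

Definition closed_coloring theta c : Prop :=
  forall beta i, i <= theta -> accp (D_le c i beta) `<=` D_le c i beta.

Definition boundary theta c : set K :=
  [set beta | acc [set: K] beta /\
    forall gamma i, i < theta -> osup (D_le c i gamma `&` below beta) < beta].

Definition coherent S c : Prop :=
  forall beta gamma delta, S beta -> beta <= gamma -> gamma < delta ->
    osup [set alpha | alpha < beta /\ c alpha gamma <> c alpha delta] < beta.

End Ordinals.

(* Main.v *)
Require Import Defs.
From mathcomp Require Import all_boot all_order.
From mathcomp Require Import all_classical wochoice.

Local Open Scope classical_set_scope.
Local Open Scope order_scope.

Import Order.TTheory.

(** A coloring c with S contained in its boundary prevents S from reflecting.
    Let gamma have uncountable cofinality.  If cf gamma <= theta, the points of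
    a continuous cofinal sequence of length cf gamma have cofinality below theta
    ([club_small_cf]), so this club misses S.  If cf gamma > theta, then gamma is
    the union of the theta many sets [D_le c i gamma], so one of them is unbounded
    in gamma; its accumulation points form a club ([accp_club]), and none of them
    is in the boundary of c.

    Conversely, if S does not reflect, every gamma has a closed cofinal subset
    C gamma with no accumulation point below gamma in S
    ([nonreflecting_ladder]): a club disjoint from S when cf gamma is
    uncountable, and otherwise a set of order type at most omega
    ([ladder_cf_le_omega]).  For alpha < gamma write p alpha for the least member
    of C gamma that is at least alpha; as p alpha < gamma, a coloring can be
    defined by recursion on its second argument by

      c alpha gamma = max (j alpha) (c alpha (p alpha))

    or just j alpha when p alpha = alpha.  Here j, which depends on gamma too, is
    weakly increasing and left continuous, has values below theta, and for gamma
    in S the set of alpha with j alpha <= i is bounded in gamma for each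
    i < theta ([exists_ranking]); outside S one can take j = 0.  The recursion
    unfolds to a maximum along a walk from gamma down to alpha.

    The point is that p is constant on an interval (e, alpha] unless alpha is an
    accumulation point of C gamma, so that just below any other alpha the
    colorings c _ gamma and c _ (p alpha) differ only through j.  If beta < gamma
    is in S, then j stays at most j beta < theta below beta, while c _ beta
    eventually exceeds every i < theta because of its own term j; so by induction
    c _ gamma agrees with c _ beta near beta.  This is coherence, and it transfers
    to gamma that the sets [D_le c i beta] are bounded in beta, so S is contained
    in the boundary.  Closedness follows by a similar induction from that of
    C gamma and of the level sets of j. *)

(** * Least elements, recursion and suprema in a well-order *)

Section WellOrder.
Set Implicit Arguments.
Unset Strict Implicit.
Context (d : Order.disp_t) (K : bOrderType d).
Context (K_wo : well_order (<=%O : rel K)).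
Implicit Types (A C S : set K) (b e t x y : K).

Lemma leastP A x : A x -> A (least A) /\ lbound A (least A).
Proof.
move=> Ax; suff : (A `&` lbound A) (least A) by [].
have [|z [[zA zlb] _]] := @K_wo [pred z | `[< A z >]].
  by exists x; rewrite inE.
apply: (@xgetI _ _ _ z); split; first by rewrite inE in zA.
by move=> y Ay; apply: zlb; rewrite inE.
Qed.

Lemma least_mem A x : A x -> A (least A).
Proof. by move=> /leastP[]. Qed.

Lemma least_le A x : A x -> least A <= x.
Proof. by move=> Ax; have [_] := leastP Ax; apply. Qed.

Lemma lt_ind (P : K -> Prop) :
  (forall x, (forall y, y < x -> P y) -> P x) -> forall x, P x.
Proof.
move=> IH x; apply: contrapT => nPx.
have nP : ~ P (least [set y | ~ P y]) := least_mem (A := [set y | ~ P y]) nPx.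
apply: nP; apply: IH => y; rewrite ltNge => /negP ylt.
by apply: contrapT => nPy; apply: ylt; apply: least_le.
Qed.

(** The step function F is total and gets the default t0 outside the values
    already computed, so that F can be written without proofs of y < x. *)
Lemma lt_rec (T : Type) (t0 : T) (F : K -> (K -> T) -> T) :
  exists f : K -> T,
    forall x, f x = F x (fun y => if y < x then f y else t0).
Proof.
have wf : well_founded (fun x y : K => is_true (x < y)).
  by move=> x; elim/lt_ind: x => x IH; constructor.
pose G x (g : forall y, y < x -> T) :=
  F x (fun y => if pselect (y < x) is left yx then g y yx else t0).
exists (Fix wf (fun=> T) G) => x.
rewrite Fix_eq; last first.
  move=> {}x g g' gg'; congr (F x _); apply/funext => y.
  by case: pselect => // yx; rewrite gg'.
congr (F x _); apply/funext => y.
by case: pselect => [yx|/negP/negPf ->]; rewrite ?yx.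
Qed.

Lemma osup_le A x : ubound A x -> osup A <= x.
Proof.
move=> Ax; rewrite /osup /supremum; case: ifP => _; first exact: le0x.
case: xgetP => [y _ [_ ylb]|_]; [exact: ylb | exact: le0x].
Qed.

Lemma le_osup A x y : ubound A x -> A y -> y <= osup A.
Proof.
move=> Ax Ay; rewrite /osup /supremum.
case: ifPn => [/eqP A0|_]; first by rewrite A0 in Ay.
have : supremums A (xget \bot (supremums A)).
  apply: xgetI; exact: leastP Ax.
by case=> Hub _; apply: Hub.
Qed.

(** For b > 0 this says that the part of A below b has supremum b; at b = 0 it is
    vacuously true, which is why b > 0 is often asked for separately. *)
Definition limit_of A b := forall e, e < b -> exists2 a, A a & e < a < b.

Lemma not_limit_of A b : ~ limit_of A b ->
  exists2 e, e < b & forall a, A a -> a < b -> a <= e.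
Proof.
move=> /existsNP[e /not_implyP[eb H]]; exists e => // a Aa ab.
by rewrite leNgt; apply/negP => ea; apply: H; exists a => //; rewrite ea.
Qed.

Lemma sub_limit_of A C b : (forall a, a < b -> A a -> C a) ->
  limit_of A b -> limit_of C b.
Proof.
move=> AC lA e /lA[a Aa /andP[ea ab]].
by exists a; [exact: AC | rewrite ea].
Qed.

Lemma limit_of_above A b e : e < b -> limit_of A b ->
  limit_of (A `&` [set a | e < a]) b.
Proof.
move=> eb lA x xb; have [|a Aa] := lA (Order.max x e); first by rewrite gt_max xb.
by rewrite gt_max => /andP[/andP[xa ea] ab]; exists a => //; rewrite xa.
Qed.

Lemma osup_ltP A b : \bot < b -> osup (A `&` below b) < b <-> ~ limit_of A b.
Proof.
move=> b0; split=> [sb lA|/not_limit_of[e eb H]].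
  have [a Aa /andP[sa ab]] := lA _ sb.
  suff : a <= osup (A `&` below b) by rewrite leNgt sa.
  by apply: (@le_osup _ b) => // x [_ /ltW].
by apply: le_lt_trans eb; apply: osup_le => a [Aa ab]; apply: H.
Qed.

Lemma osup_eqP A b : \bot < b -> osup (A `&` below b) = b <-> limit_of A b.
Proof.
move=> b0; have sb : osup (A `&` below b) <= b by apply: osup_le => x [_ /ltW].
split=> [E|lA].
  by apply: contrapT => /(osup_ltP A b0).2; rewrite E ltxx.
apply/eqP; rewrite eq_le sb leNgt; apply/negP => /(osup_ltP A b0).
exact.
Qed.

Lemma accpP A b :
  accp A b <-> [/\ exists2 a, A a & b <= a, \bot < b & limit_of A b].
Proof.
split=> [[[a Aa ba] [E b0]]|[[a Aa ba] b0 lA]].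
  by split=> //; [exists a | apply/osup_eqP].
by split; [exists a | split=> //; apply/osup_eqP].
Qed.

Lemma acc_setTP b : acc [set: K] b <-> \bot < b /\ limit_of [set: K] b.
Proof.
split=> [[_ /accpP[]] //|[b0 lb]]; split=> //; apply/accpP.
by split=> //; exists b.
Qed.

(** * Cofinality and limits *)

Lemma club_cofinal gamma C : \bot < gamma -> club gamma C ->
  forall alpha, alpha < gamma -> exists2 xi, C xi & alpha <= xi.
Proof.
move=> g0 [Cg /esym E _] alpha ag; apply: contrapT => H.
move: ag; rewrite E ltNge => /negP; apply; apply: osup_le => x Cx.
by rewrite leNgt; apply/negP => ax; apply: H; exists x => //; exact: ltW.
Qed.

(** This is the way successors are excluded below: a set with a maximum has
    cofinality at most 1, hence at most any nonzero t. *)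
Lemma max_cofinal A m t :
  A m -> ubound A m -> \bot < t -> has_cofinal_map t A.
Proof.
move=> Am mA t0; exists (fun=> m); split=> // a /mA am.
by exists \bot.
Qed.

Lemma regular_unbounded A x :
  infinite_regular_cardinal A -> A x -> exists2 y, A y & x < y.
Proof.
move=> [Ainf _ Areg] Ax; apply: contrapT => H.
have xA : ubound A x.
  by move=> y Ay; rewrite leNgt; apply/negP => xy; apply: H; exists y.
have [t At t0] : exists2 t, A t & \bot < t.
  apply: contrapT => H'; apply: Ainf.
  apply: sub_finite_set (finite_set1 \bot) => t At /=.
  apply/eqP; rewrite eq_le le0x andbT leNgt; apply/negP => t0.
  by apply: H'; exists t.
by apply: (Areg t At); apply: max_cofinal xA t0.
Qed.

Lemma regular_limit t : infinite_regular_cardinal (below t) ->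
  \bot < t /\ limit_of [set: K] t.
Proof.
move=> treg; have [tinf _ _] := treg; split.
  have [x xt] := infinite_setN0 tinf.
  by apply: le_lt_trans xt; rewrite le0x.
move=> e et; have [y yt ey] := regular_unbounded treg et.
by exists y => //; rewrite ey.
Qed.

Lemma cf_cofinal b : has_cofinal_map (cf b) (below b).
Proof.
apply: (@least_mem [set tau | has_cofinal_map tau (below b)] b).
by exists id; split=> // a ab; exists a.
Qed.

Lemma cf_le b t : has_cofinal_map t (below b) -> cf b <= t.
Proof. by move=> H; apply: least_le. Qed.

Lemma lt_cf_gt0 b t : t < cf b -> \bot < b.
Proof.
move=> tb; rewrite lt0x; apply/eqP => b0.
suff : cf b <= \bot by rewrite leNgt (le_lt_trans (le0x t)).
by apply: cf_le; exists id; rewrite b0; split=> x; rewrite /below /= ltx0.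
Qed.

Lemma lt_cf_limit b t : \bot < t -> t < cf b ->
  \bot < b /\ limit_of [set: K] b.
Proof.
move=> t0 tb; split; first exact: lt_cf_gt0 tb.
apply: contrapT => /not_limit_of[e eb H].
suff : cf b <= t by rewrite leNgt tb.
by apply: cf_le; apply: (max_cofinal (m := e)) => // x xb; apply: H.
Qed.

(** If cf b had a last index e, then f e could be dropped from a cofinal map f,
    since b is a limit and some later value exceeds f e; the map f would then be
    cofinal already on e. *)
Lemma limit_of_cf b t : \bot < t -> t < cf b -> limit_of [set: K] (cf b).
Proof.
move=> t0 tb; have [b0 bl] := lt_cf_limit t0 tb.
apply: contrapT => /not_limit_of[e eb He].
have [f [fb fcof]] := cf_cofinal b.
suff : cf b <= e by rewrite leNgt eb.
apply: cf_le; exists f; split.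
  by move=> xi xie; apply: fb; apply: lt_trans eb.
move=> a ab; have [a' _ /andP[fa a'b]] := bl _ (fb _ eb).
have [xi xib] : exists2 xi, xi < cf b & Order.max a a' <= f xi.
  by apply: fcof; rewrite /below /= gt_max ab.
rewrite ge_max => /andP[axi a'xi]; exists xi => //.
rewrite lt_neqAle He // andbT; apply: contraTneq a'xi => ->.
by rewrite -ltNge.
Qed.

Lemma omega_le b : \bot < b -> limit_of [set: K] b -> omega <= b.
Proof. by move=> b0 bl; apply: least_le; apply/acc_setTP. Qed.

Lemma omega_limit b : \bot < b -> limit_of [set: K] b ->
  \bot < (omega : K) /\ limit_of [set: K] omega.
Proof.
move=> b0 bl; apply/acc_setTP; apply: (@least_mem (acc [set: K]) b).
exact/acc_setTP.
Qed.

(** * Ladders avoiding S *)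

(** A finite set has no accumulation point: n > 0 is a successor e + 1, and
    removing the single value f e does not affect accumulation at b. *)
Lemma finite_no_limit (f : K -> K) n b : n < omega -> \bot < b ->
  ~ limit_of [set f m | m in below n] b.
Proof.
elim/lt_ind: n => n IH no b0 lb.
have [_ [m0 m0n _] _] := lb _ b0.
have /not_limit_of[e en He] : ~ limit_of [set: K] n.
  move=> /(omega_le (le_lt_trans (le0x m0) m0n)).
  by rewrite leNgt no.
have /not_limit_of[x xb Hx] := IH e en (lt_trans en no) b0.
have [|a [m mn <-]] := lb (Order.max x (if f e < b then f e else \bot)).
  by rewrite gt_max xb; case: ifP.
rewrite gt_max => /andP[/andP[xm fem] mb].
move: (He m I mn); rewrite le_eqVlt => /predU1P[me|me].
  by rewrite -me mb ltxx in fem.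
have : f m <= x by apply: Hx => //; exists m.
by rewrite leNgt xm.
Qed.

(** The sets along which the coloring is defined.  Cofinality is stated with a
    weak inequality, so that a ladder of a successor contains its predecessor and
    the empty set is a ladder of 0; no case distinction on gamma is then needed. *)
Definition ladder S gamma C : Prop :=
  [/\ C `<=` below gamma,
      forall alpha, alpha < gamma -> exists2 xi, C xi & alpha <= xi
    & forall alpha, alpha < gamma -> \bot < alpha -> limit_of C alpha ->
        C alpha /\ ~ S alpha].

(** The record values of a cofinal map are still cofinal, and only records with
    index below n can lie below f n.  So just finitely many lie below any
    alpha < gamma, which leaves no accumulation point. *)
Lemma ladder_cf_le_omega S gamma : cf gamma <= omega ->
  exists C, ladder S gamma C.
Proof.
move=> cfo; have [f [fg fcof]] := cf_cofinal gamma.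
exists [set f n | n in [set n | n < cf gamma /\ forall m, m < n -> f m < f n]].
split=> [_ [n [nc _] <-]|alpha ag|alpha ag a0 lC]; first exact: fg.
  have [n0 n0c n0a] := fcof _ ag.
  have [] := @leastP [set n | n < cf gamma /\ alpha <= f n] n0 (conj n0c n0a).
  set n := least _ => -[nc na] nmin; exists (f n) => //.
  exists n => //; split=> // m mn; apply: lt_le_trans na.
  rewrite ltNge; apply/negP => am.
  have : n <= m by apply: nmin; split=> //; apply: lt_trans nc.
  by rewrite leNgt mn.
exfalso; have [n nc an] := fcof _ ag.
apply: (@finite_no_limit f n alpha (lt_le_trans nc cfo) a0).
apply: sub_limit_of lC => a aa [m [mc mrec] fm]; rewrite -{}fm in aa *.
exists m => //.
rewrite /below /= ltNge le_eqVlt; apply/negP => /predU1P[nm|/mrec nm].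
  by rewrite -nm ltNge an in aa.
by have := lt_trans nm aa; rewrite ltNge an.
Qed.

Lemma nonreflecting_ladder S gamma :
  (E_gt_omega gamma -> ~ stationary gamma (S `&` below gamma)) ->
  exists C, ladder S gamma C.
Proof.
move=> nst; case: (leP (cf gamma) omega) => [|ocf]; first exact: ladder_cf_le_omega.
have g0 : \bot < gamma := lt_cf_gt0 ocf.
have /not_andP[H|/existsNP[C /not_implyP[clubC disj]]] := nst ocf.
  by exfalso; apply: H => x [].
exists C; have [Cg _ Cacc] := clubC; split=> // [|alpha ag a0 lC].
  exact: club_cofinal.
have Ca : C alpha.
  apply: Cacc; apply/accpP; split=> //.
  exact: club_cofinal clubC _ ag.
by split=> // Sa; apply: disj; exists alpha.
Qed.

(** * Closed rankings of the ordinals below gamma *)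

(** The conditions on alpha make j weakly increasing and left continuous, so
    that each level set is a closed initial segment of gamma; at gamma in S the
    level sets are moreover bounded, so j then climbs to theta. *)
Definition ranking theta S gamma (j : K -> K) : Prop :=
  [/\ forall alpha, alpha < gamma -> j alpha < theta,
      forall alpha beta, alpha <= beta -> beta < gamma -> j alpha <= j beta,
      forall alpha i, alpha < gamma ->
        limit_of [set xi | j xi <= i] alpha -> j alpha <= i
    & S gamma -> forall i, i < theta -> ~ limit_of [set xi | j xi <= i] gamma].

(** For gamma in S take a cofinal map f from theta to gamma and let j alpha be
    the least xi such that the strict supremum of f on [0, xi] is at least alpha.
    The level set of i consists of the alpha up to the strict supremum of f on
    [0, i], hence is bounded as i + 1 < theta = cf gamma.  Quantifying over the
    x < alpha, instead of asking f eta >= alpha, is what makes the level sets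
    closed.  For gamma outside S the zero function will do. *)
Lemma exists_ranking theta S gamma :
  infinite_regular_cardinal (below theta) -> S `<=` E_eq theta ->
  exists j, ranking theta S gamma j.
Proof.
move=> treg Sc; have [t0 tl] := regular_limit treg.
have [/Sc cft|nSg] := pselect (S gamma); last first.
  by exists (fun=> \bot); split=> // *; rewrite le0x.
have [f [fg fcof]] := cf_cofinal gamma; rewrite cft in fg fcof.
pose covers alpha xi :=
  forall x, x < alpha -> exists2 eta, eta <= xi & x <= f eta.
have cov alpha : alpha < gamma -> exists2 xi, xi < theta & covers alpha xi.
  move=> /fcof[xi xit axi]; exists xi => // x xa.
  by exists xi => //; apply: le_trans axi; apply: ltW.
pose j alpha := least (covers alpha).
have jP alpha i : alpha < gamma -> j alpha <= i <-> covers alpha i.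
  move=> ag; have [xi _ axi] := cov _ ag; split; last exact: least_le.
  move=> ji x /(least_mem axi)[eta etaj xeta].
  by exists eta => //; apply: le_trans ji.
exists j; split=> [alpha ag|alpha beta ab bg|alpha i ag lj|_ i it lj].
- have [xi xit axi] := cov _ ag.
  by apply: le_lt_trans xit; apply/jP.
- apply/jP; first exact: le_lt_trans bg.
  have /(jP _ _ bg) cb := lexx (j beta).
  by move=> x xa; apply: cb; apply: lt_le_trans ab.
- apply/jP => // x /lj[y jy /andP[xy ya]].
  by move/jP: jy; apply=> //; apply: lt_trans ag.
- have [i' _ /andP[ii' i't]] := tl _ it.
  suff : cf gamma <= i' by rewrite cft leNgt i't.
  apply: cf_le; exists f; split=> [xi xii'|x xg].
    by apply: fg; apply: lt_trans i't.
  have [y jy /andP[xy yg]] := lj _ xg.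
  have [eta etai xeta] := (jP _ _ yg).1 jy _ xy.
  by exists eta => //; apply: le_lt_trans ii'.
Qed.

End WellOrder.

(** * The coloring defined by ladders and rankings *)

Section Coloring.
Set Implicit Arguments.
Unset Strict Implicit.
Context (d : Order.disp_t) (K : bOrderType d).
Context (K_wo : well_order (<=%O : rel K)).
Context (theta : K) (S : set K) (C : K -> set K) (j : K -> K -> K).
Context (theta_gt0 : \bot < theta).
Context (S_limit : forall beta, S beta ->
  \bot < beta /\ limit_of [set: K] beta).
Context (CP : forall gamma, ladder S gamma (C gamma)).
Context (jP : forall gamma, ranking theta S gamma (j gamma)).

(** The step from gamma towards alpha, as in a walk along the ladders. *)
Let p gamma alpha := least (C gamma `&` [set xi | alpha <= xi]).

Let pP gamma alpha : alpha < gamma ->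
  [/\ C gamma (p gamma alpha), alpha <= p gamma alpha & p gamma alpha < gamma].
Proof.
move=> ag; have [Cg Ccof _] := CP gamma.
have [xi Cxi axi] := Ccof _ ag.
have [Cp ap] := least_mem K_wo (A := C gamma `&` [set xi | alpha <= xi])
  (conj Cxi axi).
by split=> //; apply: Cg.
Qed.

Let p_fix gamma alpha : C gamma alpha -> p gamma alpha = alpha.
Proof.
move=> Ca; have [Cg _ _] := CP gamma; have [_ ap _] := pP (Cg _ Ca).
by apply/eqP; rewrite eq_le ap andbT; apply: least_le => //; split=> /=.
Qed.

(** All of the induction rests on this: to the left of a non-accumulation point
    of C gamma there is a gap of C gamma, on which the step does not change. *)
Let p_locally_constant gamma alpha : \bot < alpha -> alpha < gamma ->
  ~ limit_of (C gamma) alpha ->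
  exists2 e, e < alpha &
    forall x, e < x -> x <= alpha -> p gamma x = p gamma alpha.
Proof.
move=> a0 ag /not_limit_of[e ea He]; exists e => // x ex xa.
have [Cx xp _] := pP (le_lt_trans xa ag); have [Ca ap _] := pP ag.
apply/eqP; rewrite eq_le; apply/andP; split; apply: least_le => //; split=> //=.
  exact: le_trans xa ap.
rewrite leNgt; apply/negP => pa.
by have := He _ Cx pa; rewrite leNgt (lt_le_trans ex xp).
Qed.

Let coloring_exists : exists c : K -> K -> K, forall alpha gamma,
  alpha < gamma -> c alpha gamma =
    Order.max (j gamma alpha)
      (if alpha < p gamma alpha then c alpha (p gamma alpha) else \bot).
Proof.
have [c cE] := lt_rec K_wo (fun=> \bot) (fun gamma (g : K -> K -> K) alpha =>
  Order.max (j gamma alpha)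
    (if alpha < p gamma alpha then g (p gamma alpha) alpha else \bot)).
exists (fun alpha gamma => c gamma alpha) => alpha gamma ag.
by rewrite cE; have [_ _ ->] := pP ag.
Qed.

(** Everything near beta in S is read off from c _ beta: by c_coh below, every
    c _ gamma with gamma >= beta agrees with it on a final segment of beta, which
    gives coherence at once, and the boundary through c_bounded. *)
Lemma coloring_of_ladders : exists c : K -> K -> K,
  [/\ coloring theta c, coherent S c, closed_coloring theta c
    & S `<=` boundary theta c].
Proof.
have [c cE] := coloring_exists.
have c_ge alpha gamma : alpha < gamma -> j gamma alpha <= c alpha gamma.
  by move=> ag; rewrite cE // le_max lexx.
(* The term j gamma alone makes the color classes at gamma in S bounded. *)
have c_bounded gamma i : S gamma -> i < theta ->
    exists2 e, e < gamma & forall x, e < x -> x < gamma -> i < c x gamma.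
  move=> Sg it; have [_ _ _ /(_ Sg _ it)/not_limit_of[e eg He]] := jP gamma.
  exists e => // x ex xg; rewrite ltNge; apply/negP => ci.
  have : x <= e by apply: He => //=; apply: le_trans ci; exact: c_ge.
  by rewrite leNgt ex.
have c_coh beta gamma : S beta -> beta <= gamma ->
    exists2 e, e < beta & forall x, e < x -> x < beta -> c x gamma = c x beta.
  move=> Sb; elim/(lt_ind K_wo): gamma => gamma IH.
  have [b0 _] := S_limit Sb.
  rewrite le_eqVlt => /predU1P[<-|bg]; first by exists \bot.
  have [_ _ Cacc] := CP gamma.
  have [|e1 e1b He1] := p_locally_constant b0 bg.
    by move=> /(Cacc _ bg b0)[].
  have [_ bp pg] := pP bg; have [e2 e2b He2] := IH _ pg bp.
  have [jt jmono _ _] := jP gamma.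
  (* Beyond e3 the colors at beta exceed j gamma beta, which absorbs j gamma. *)
  have [e3 e3b He3] := c_bounded _ _ Sb (jt _ bg).
  exists (Order.max e1 (Order.max e2 e3)); first by rewrite !gt_max e1b e2b.
  move=> x; rewrite !gt_max => /and3P[e1x e2x e3x] xb.
  rewrite (cE _ _ (lt_trans xb bg)) (He1 _ e1x (ltW xb)) (lt_le_trans xb bp) He2 //.
  apply: max_r; apply: le_trans (ltW (He3 _ e3x xb)).
  exact: jmono (ltW xb) bg.
exists c; split.
- move=> alpha gamma; elim/(lt_ind K_wo): gamma => gamma IH ag.
  have [jt _ _ _] := jP gamma; have [_ _ pg] := pP ag.
  rewrite cE // gt_max jt //=; case: ifP => // ap.
  exact: IH.
- move=> beta gamma delta Sb bg gd; have [b0 _] := S_limit Sb.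
  have [e1 e1b He1] := c_coh _ _ Sb bg.
  have [e2 e2b He2] := c_coh _ _ Sb (le_trans bg (ltW gd)).
  apply: (@le_lt_trans _ _ (Order.max e1 e2)); last by rewrite gt_max e1b.
  apply: osup_le => x [xb ne]; rewrite leNgt; apply/negP.
  by rewrite gt_max => /andP[e1x e2x]; apply: ne; rewrite He1 ?He2.
- move=> gamma i _ alpha /(accpP K_wo)[[a [ag _] aa] a0].
  have {a aa ag} : alpha < gamma by apply: le_lt_trans aa ag.
  elim/(lt_ind K_wo): gamma => gamma IH ag lD; split=> //.
  have [_ _ jclosed _] := jP gamma; have [_ ap pg] := pP ag.
  rewrite cE // ge_max jclosed //=; last first.
    apply: sub_limit_of lD => x _ [xg]; apply: le_trans; exact: c_ge.
  case: ifP => // altp; have [_ _ Cacc] := CP gamma.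
  have [|e ea He] := p_locally_constant a0 ag.
    by move=> /(Cacc _ ag a0)[/p_fix pa _]; rewrite pa ltxx in altp.
  apply: (IH _ pg altp _).2.
  apply: sub_limit_of (limit_of_above ea lD) => x xa [[xg cxi] ex].
  have xp := lt_le_trans xa ap.
  split=> //; apply: le_trans cxi; rewrite (cE x gamma) // He ?(ltW xa) //.
  by rewrite xp le_max lexx orbT.
- move=> beta Sb; have [b0 bl] := S_limit Sb.
  split=> [|gamma i it]; first exact/(acc_setTP K_wo).
  apply/(osup_ltP K_wo) => // lD.
  have [gb|bg] := ltP gamma beta.
    by have [x [xg _] /andP[gx _]] := lD _ gb; rewrite ltNge (ltW xg) in gx.
  have [e1 e1b He1] := c_coh _ _ Sb bg.
  have [e2 e2b He2] := c_bounded _ _ Sb it.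
  have [|x [xg cxi]] := lD (Order.max e1 e2); first by rewrite gt_max e1b.
  rewrite gt_max => /andP[/andP[e1x e2x] xb].
  by have := He2 _ e2x xb; rewrite -He1 // ltNge cxi.
Qed.

End Coloring.

(** * Colorings whose boundary contains S prevent reflection *)

Section Reflection.
Set Implicit Arguments.
Unset Strict Implicit.
Context (d : Order.disp_t) (K : bOrderType d).
Context (K_wo : well_order (<=%O : rel K)).

Implicit Types (A C S : set K).

Lemma limit_succ b x : limit_of [set: K] b -> x < b ->
  exists2 s, s < b & forall y, (y < s) = (y <= x).
Proof.
move=> bl /bl[s _ /andP[xs sb]].
have [xn nmin] := leastP K_wo (A := [set y | x < y]) xs.
exists (least [set y | x < y]); first by apply: le_lt_trans sb; apply: nmin.
move=> y; apply/idP/idP => [|yx]; last exact: le_lt_trans yx xn.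
by rewrite ltNge => /negP yn; rewrite leNgt; apply/negP => /nmin.
Qed.

Lemma unbounded_osup gamma C : C `<=` below gamma ->
  (forall alpha, alpha < gamma -> exists2 x, C x & alpha < x) ->
  osup C = gamma.
Proof.
move=> Cg H; have ubg : ubound C gamma by move=> x /Cg/ltW.
apply/eqP; rewrite eq_le osup_le //= leNgt; apply/negP => /H[x Cx].
by rewrite ltNge (le_osup K_wo ubg Cx).
Qed.

(** The club consists of the strict suprema of a cofinal map f on the proper
    initial segments of cf gamma.  It is closed: given a limit delta of such
    suprema and the first xi with f xi >= delta, every one of them below delta
    only uses indices below xi, so delta is the strict supremum of f on xi. *)
Lemma club_small_cf (gamma t : K) : \bot < t -> t < cf gamma ->
  exists2 C, club gamma C & forall delta, C delta -> cf delta < cf gamma.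
Proof.
move=> t0 tc; have [g0 gl] := lt_cf_limit K_wo t0 tc.
have cl := limit_of_cf K_wo t0 tc.
have [f [fg fcof]] := cf_cofinal K_wo gamma.
pose cofinal_at delta xi := (forall eta, eta < xi -> f eta < delta) /\
  (forall x, x < delta -> exists2 eta, eta < xi & x <= f eta).
have first_above a : a < gamma -> exists xi,
    [/\ xi < cf gamma, a <= f xi & forall eta, eta < xi -> f eta < a].
  move=> ag; have [x0 x0c ax0] := fcof _ ag.
  have [axi xmin] := leastP K_wo (A := [set xi | a <= f xi]) ax0.
  exists (least [set xi | a <= f xi]); split=> //.
    by apply: le_lt_trans x0c; apply: xmin.
  move=> eta; rewrite !ltNge => /negP etax; apply/negP => aeta.
  by apply: etax; apply: xmin.
exists [set delta | delta < gamma /\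
    exists2 xi, xi < cf gamma & cofinal_at delta xi]; last first.
  move=> delta [_ [xi xic atxi]]; apply: le_lt_trans xic.
  by apply: cf_le => //; exists f.
split=> [x []//||delta /(accpP K_wo)[[a [ag _] da] d0 dl]].
  apply: unbounded_osup => [x []//|a ag].
  have [xi [xic axi xmin]] := first_above _ ag.
  have [delta dg dE] := limit_succ gl (fg _ xic).
  have [xi' xi'c xi'E] := limit_succ cl xic.
  (* delta is f xi + 1; as f xi exceeds all earlier values, delta is the strict
     supremum of f on xi' = xi + 1. *)
  exists delta; last first.
    by rewrite (le_lt_trans axi) // dE.
  split=> //; exists xi' => //; split=> [eta|x].
    rewrite xi'E dE le_eqVlt => /predU1P[->//|/xmin etaa].
    exact: le_trans (ltW etaa) axi.
  by rewrite dE => xf; exists xi; rewrite ?xi'E.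
have dg := le_lt_trans da ag; split=> //.
have [xi [xic dxi xmin]] := first_above _ dg.
exists xi => //; split=> // x /dl[b [_ [zeta _ [zb bz]]] /andP[xb bd]].
have [eta etaz xeta] := bz _ xb; exists eta => //.
apply: (lt_le_trans etaz); rewrite leNgt; apply/negP => /zb.
by rewrite ltNge (ltW (lt_le_trans bd dxi)).
Qed.

(** Above alpha, an increasing sequence of omega members of A is bounded in gamma
    because cf gamma > omega, and its supremum accumulates A. *)
Lemma accp_club gamma A : \bot < (omega : K) -> limit_of [set: K] omega ->
  omega < cf gamma -> A `<=` below gamma -> limit_of A gamma ->
  club gamma (accp A).
Proof.
move=> o0 ol ocf Ag Al.
have Cg : accp A `<=` below gamma.
  by move=> x /(accpP K_wo)[[a /Ag ag xa] _ _]; apply: le_lt_trans ag.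
split=> //; last first.
  move=> x /(accpP K_wo)[[a /(accpP K_wo)[[a' Aa' aa'] _ _] xa] x0 xl].
  apply/(accpP K_wo); split=> //; first by exists a' => //; apply: le_trans aa'.
  move=> e /xl[b /(accpP K_wo)[_ _ bl] /andP[eb bx]].
  have [y Ay /andP[ey yb]] := bl _ eb.
  by exists y => //; rewrite ey (lt_trans yb).
apply: unbounded_osup => // alpha ag.
have [f fE] := lt_rec K_wo \bot (fun n g =>
  least (A `&` [set x | alpha < x /\ forall m, m < n -> g m < x])).
have fP n : n < omega ->
    [/\ A (f n), alpha < f n & forall m, m < n -> f m < f n].
  elim/(lt_ind K_wo): n => n IH no.
  suff [y [Ay ay yn]] : exists y,
      [/\ A y, alpha < y & forall m, m < n -> f m < y].
    have [|fA [fa fn]] := @least_mem _ _ K_wo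
      (A `&` [set x | alpha < x /\
        forall m, m < n -> (if m < n then f m else \bot) < x]) y.
      by split=> //; split=> // m mn; rewrite mn; apply: yn.
    by rewrite -fE in fA fa fn; split=> // m mn; have := fn _ mn; rewrite mn.
  have [[m0 m0n]|nmin] := pselect (exists m, m < n); last first.
    have [y Ay /andP[ay _]] := Al _ ag.
    by exists y; split=> // m mn; case: nmin; exists m.
  have /not_limit_of[e en He] : ~ limit_of [set: K] n.
    move=> /(omega_le K_wo (le_lt_trans (le0x m0) m0n)).
    by rewrite leNgt no.
  have [/Ag eg ae fe] := IH e en (lt_trans en no).
  have [y Ay /andP[ey yg]] := Al _ eg.
  exists y; split=> // [|m /(He _ I)]; first exact: lt_trans ey.
  by rewrite le_eqVlt => /predU1P[->//|/fe me]; apply: lt_trans ey.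
have [b bg bf] : exists2 b, b < gamma & forall n, n < omega -> f n < b.
  apply: contrapT => H.
  suff : cf gamma <= omega by rewrite leNgt ocf.
  apply: cf_le => //; exists f; split=> [n /fP[/Ag]//|x xg].
  apply: contrapT => H'; apply: H; exists x => // n no.
  by rewrite ltNge; apply/negP => xn; apply: H'; exists n.
have [df dmin] := leastP K_wo (A := [set b | forall n, n < omega -> f n < b]) bf.
set delta := least _ in df dmin.
have ad : alpha < delta.
  by have [_ af _] := fP _ o0; apply: lt_trans af (df _ o0).
exists delta => //; apply/(accpP K_wo); split.
- have [a Aa /andP[ba _]] := Al _ bg; exists a => //.
  by apply: le_trans (ltW ba); apply: dmin.
- exact: le_lt_trans (le0x alpha) ad.
- move=> e ed; have [n no en] : exists2 n, n < omega & e <= f n.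
    apply: contrapT => H; move: ed; rewrite ltNge => /negP; apply; apply: dmin.
    by move=> n no; rewrite ltNge; apply/negP => en; apply: H; exists n.
  have [n' _ /andP[nn' n'o]] := ol _ no; have [Af _ fn'] := fP _ n'o.
  by exists (f n') => //; rewrite (le_lt_trans en (fn' _ nn')) df.
Qed.

Lemma boundary_nonreflecting (theta : K) S c gamma :
  \bot < theta -> limit_of [set: K] theta ->
  S `<=` E_eq theta -> coloring theta c -> S `<=` boundary theta c ->
  E_gt_omega gamma -> ~ stationary gamma (S `&` below gamma).
Proof.
move=> t0 tl Sc ccol Sb ocf [_ stat].
have [o0 ol] := omega_limit K_wo t0 tl.
have [ct|tc] := leP (cf gamma) theta.
  have [C clubC Ccf] := club_small_cf o0 ocf.
  have [delta [[/Sc dt _] /Ccf]] := stat _ clubC.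
  by rewrite dt ltNge ct.
have [i it lD] : exists2 i, i < theta & limit_of (D_le c i gamma) gamma.
  apply: contrapT => H.
  have /choice[f fP] i : exists e, i < theta ->
      e < gamma /\ forall a, a < gamma -> c a gamma <= i -> a <= e.
    have [it|] := pselect (i < theta); last by exists \bot.
    have /not_limit_of[e eg He] : ~ limit_of (D_le c i gamma) gamma.
      by move=> l; apply: H; exists i.
    by exists e => _; split=> // a ag ca; apply: He.
  suff : cf gamma <= theta by rewrite leNgt tc.
  apply: cf_le => //; exists f; split=> [i /fP[]//|a ag].
  exists (c a gamma); first exact: ccol.
  by have [_] := fP _ (ccol _ _ ag); apply.
have clubD := accp_club o0 ol ocf (fun x => @proj1 _ _) lD.
have [beta [[/Sb[/(acc_setTP K_wo)[b0 _] bS] _]]] := stat _ clubD.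
move=> /(accpP K_wo)[_ _].
by apply/(osup_ltP K_wo) => //; apply: bS.
Qed.

End Reflection.

Theorem lemma3p31 (d : Order.disp_t) (K : bOrderType d) (theta : K) (S : set K)
    (K_wo : well_order (<=%O : rel K))
    (K_reg : infinite_regular_cardinal [set: K])
    (theta_reg : infinite_regular_cardinal (below theta))
    (S_sub : S `<=` E_eq theta) :
  [<-> forall gamma : K, E_gt_omega gamma -> ~ stationary gamma (S `&` below gamma);
       exists c : K -> K -> K, coloring theta c /\ S `<=` boundary theta c;
       exists c : K -> K -> K,
         [/\ coloring theta c, coherent S c, closed_coloring theta c
           & S `<=` boundary theta c]].
Proof.
have [theta_gt0 theta_limit] := regular_limit theta_reg.
have nonreflecting c : coloring theta c -> S `<=` boundary theta c ->
    forall gamma : K, E_gt_omega gamma -> ~ stationary gamma (S `&` below gamma).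
  move=> ccol Sc gamma.
  exact: (boundary_nonreflecting K_wo theta_gt0 theta_limit S_sub ccol Sc).
have good_coloring :
    (forall gamma : K, E_gt_omega gamma -> ~ stationary gamma (S `&` below gamma)) ->
    exists c : K -> K -> K,
      [/\ coloring theta c, coherent S c, closed_coloring theta c
        & S `<=` boundary theta c].
  move=> S_nonrefl.
  have /choice[C CP] gamma : exists C, ladder S gamma C.
    exact: (nonreflecting_ladder K_wo (S_nonrefl gamma)).
  have /choice[j jP] gamma : exists j, ranking theta S gamma j.
    exact: (exists_ranking K_wo).
  apply: (coloring_of_ladders K_wo theta_gt0 _ CP jP) => beta /S_sub cfb.
  have [t _ /andP[t0 tt]] := theta_limit _ theta_gt0.
  by apply: (lt_cf_limit K_wo t0); rewrite cfb.
tfae.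
- by move=> /good_coloring[c [? _ _ ?]]; exists c.
- by move=> [c [ccol Sc]]; exact: (good_coloring (nonreflecting c ccol Sc)).
- by move=> [c [ccol _ _ Sc]]; exact: (nonreflecting c ccol Sc).
Qed.
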